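(* Let $\mathcal{P}=\{1,\dots,N\}$ and consider the family of systems $\dot x(t)=f_i(x(t))$, $i\in\mathcal{P}$, on $\mathbb{R}^d$, where each $f_i:\mathbb{R}^d\to\mathbb{R}^d$ is Lipschitz with $f_i(0)=0$. Let $\mathcal{P}=\mathcal{P}_S\sqcup\mathcal{P}_U$, and let $E(\mathcal{P})\subset\mathcal{P}\times\mathcal{P}$ be a set of admissible transitions. Suppose: (A1) there exist $\underline\alpha,\overline\alpha\in\mathcal{K}_\infty$, continuously differentiable functions $V_i:\mathbb{R}^d\to[0,+\infty[$, $i\in\mathcal{P}$, and constants $\lambda_i\in\mathbb{R}$ with $\lambda_i>0$ for $i\in\mathcal{P}_S$ and $\lambda_i<0$ for $i\in\mathcal{P}_U$, such that $\underline\alpha(\|\xi\|)\le V_i(\xi)\le\overline\alpha(\|\xi\|)$ for all $\xi\in\mathbb{R}^d$, $i\in\mathcal{P}$, and $V_i(\gamma_i(t))\le V_i(\gamma_i(0))\exp(-\lambda_i t)$ for all $t\ge0$ and every solution $\gamma_i$ of $\dot x=f_i(x)$; (A2) for every $(i,j)\in E(\mathcal{P})$ there is $\mu_{ij}\ge1$ with $V_j(\xi)\le\mu_{ij}V_i(\xi)$ for all $\xi\in\mathbb{R}^d$. Then for every admissible switching signal $\sigma$ satisfying \[ \varlimsup_{t\to+\infty}\Biggl(\nu(t)\sum_{(k,\ell)\in E(\mathcal{P})}(\ln\mu_{k\ell})\rho_{k\ell}(t)-\sum_{j\in\mathcal{P}_S}|\lambda_j|\eta_j(t)+\sum_{k\in\mathcal{P}_U}|\lambda_k|\eta_k(t)\Biggr)<0,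 \] the switched system $\dot x(t)=f_{\sigma(t)}(x(t))$, $x(0)=x_0$, $t\ge0$, is globally asymptotically stable.
   Context: An admissible switching signal is a piecewise constant, right-continuous map $\sigma:[0,+\infty[\to\mathcal{P}$ with left limits everywhere, whose jumps (switching instants $0=:\tau_0<\tau_1<\tau_2<\cdots$) are only along admissible transitions, i.e. $(\sigma(\tau_{i}),\sigma(\tau_{i+1}))\in E(\mathcal{P})$. $\mathcal{P}_S$ and $\mathcal{P}_U$ are the index sets of asymptotically stable and unstable subsystems respectively. $\mathrm{N}(s,t)$ is the number of switches on $]s,t]$; $\mathrm{N}_{k\ell}(0,t)$ is the number of switches from subsystem $k$ to subsystem $\ell$ in $]0,t]$; $\mathrm{T}_j(0,t)$ is the Lebesgue measure of the set of times in $]0,t]$ at which $\sigma=j$. For $t>0$: $\nu(t)=\mathrm{N}(0,t)/t$ (switching frequency), $\rho_{k\ell}(t)=\mathrm{N}_{k\ell}(0,t)/\mathrm{N}(0,t)$ (transition frequency), and $\eta_j(t)=\mathrm{T}_j(0,t)/t$ (fraction of activation); the product $\nu(t)\rho_{k\ell}(t)$ equals $\mathrm{N}_{k\ell}(0,t)/t$. The switched system is globally asymptotically stable (GAS) for $\sigma$ if it is Lyapunov stable and every solution converges to $0$ as $t\to+\infty$, i.e., there is a class-$\mathcal{KL}$ function $\beta_\sigma$ with $\|x(t)\|\le\beta_\sigma(\|x_0\|,t)$ for all $x_0$ and $t\ge0$. *)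

(* Defs.v *)
From HB Require Import structures.
From mathcomp Require Import all_boot all_order all_algebra.
From mathcomp Require Import all_classical all_reals all_analysis.
From mathcomp Require Import finmap.
Set Implicit Arguments. Unset Strict Implicit. Unset Printing Implicit Defensive.
Import Order.TTheory GRing.Theory Num.Theory.
Import numFieldNormedType.Exports.
Local Open Scope classical_set_scope.
Local Open Scope ring_scope.

Definition class_K (R : realType) (a : R -> R) : Prop :=
  {within `[0, +oo[%classic, continuous a} /\ a 0 = 0 /\
  (forall x y : R, 0 <= x -> x < y -> a x < a y).

Definition class_Kinf (R : realType) (a : R -> R) : Prop :=
  class_K a /\ a x @[x --> +oo] --> +oo.

Definition class_KL (R : realType) (b : R -> R -> R) : Prop :=
  (forall t : R, 0 <= t -> class_K (fun r => b r t)) /\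
  (forall r : R, 0 <= r ->
     (forall s t : R, 0 <= s -> s <= t -> b r t <= b r s) /\
     b r t @[t --> +oo] --> 0).

Definition lipschitz_map (R : realType) (d : nat) (f : 'rV[R]_d -> 'rV[R]_d) : Prop :=
  exists L : R, forall x y, `|f x - f y| <= L * `|x - y|.

Definition C1 (R : realType) (d : nat) (V : 'rV[R]_d -> R) : Prop :=
  (forall x, differentiable V x) /\ (forall v, continuous (fun x => 'D_v V x)).

Definition solution (R : realType) (d : nat) (f : 'rV[R]_d -> 'rV[R]_d)
  (g : R -> 'rV[R]_d) : Prop :=
  (forall t : R, 0 < t -> is_derive t 1 g (f (g t))) /\
  g u @[u --> 0^'+] --> g 0.

Definition switch_at (R : realType) (N : nat) (sigma : R -> 'I_N)
  (k l : 'I_N) (s : R) : Prop :=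
  0 < s /\ k != l /\ sigma s = l /\
  exists delta : R, 0 < delta /\ forall u, s - delta < u < s -> sigma u = k.

Definition switch_instant (R : realType) (N : nat) (sigma : R -> 'I_N) (s : R) : Prop :=
  exists k l, switch_at sigma k l s.

(* admissible: piecewise constant and right-continuous on [0,+oo[ (constant on
   [tau n, tau n.+1[ with tau 0 = 0, tau increasing to +oo), jumping only along
   admissible transitions of E.  Finitely many switches are allowed (tau may
   contain instants where sigma does not change). *)
Definition admissible (R : realType) (N : nat) (E : {set 'I_N * 'I_N})
  (sigma : R -> 'I_N) : Prop :=
  exists tau : nat -> R,
    tau 0%N = 0 /\ (forall n, tau n < tau n.+1) /\ tau n @[n --> \oo] --> +oo /\
    (forall n t, tau n <= t < tau n.+1 -> sigma t = sigma (tau n)) /\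
    (forall n, sigma (tau n) != sigma (tau n.+1) ->
               (sigma (tau n), sigma (tau n.+1)) \in E).

Definition Nsw (R : realType) (N : nat) (sigma : R -> 'I_N) (s t : R) : nat :=
  #|` fset_set [set u | s < u <= t /\ switch_instant sigma u] |.

Definition Nkl (R : realType) (N : nat) (sigma : R -> 'I_N) (k l : 'I_N) (t : R) : nat :=
  #|` fset_set [set u | 0 < u <= t /\ switch_at sigma k l u] |.

Definition Tact (R : realType) (N : nat) (sigma : R -> 'I_N) (j : 'I_N) (t : R) : R :=
  fine (@lebesgue_measure R ([set u | 0 < u <= t] `&` [set u | sigma u = j])).

Definition nu_sw (R : realType) (N : nat) (sigma : R -> 'I_N) (t : R) : R :=
  (Nsw sigma 0 t)%:R / t.
Definition rho_tr (R : realType) (N : nat) (sigma : R -> 'I_N) (k l : 'I_N) (t : R) : R :=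
  (Nkl sigma k l t)%:R / (Nsw sigma 0 t)%:R.
Definition eta_act (R : realType) (N : nat) (sigma : R -> 'I_N) (j : 'I_N) (t : R) : R :=
  Tact sigma j t / t.

Definition limsup_pinfty (R : realType) (g : R -> R) : \bar R :=
  limf_esup (fun t => (g t)%:E) +oo.

Definition switched_solution (R : realType) (d N : nat)
  (f : 'I_N -> 'rV[R]_d -> 'rV[R]_d) (sigma : R -> 'I_N) (x0 : 'rV[R]_d)
  (x : R -> 'rV[R]_d) : Prop :=
  x 0 = x0 /\ x u @[u --> 0^'+] --> x 0 /\
  (forall t : R, 0 < t -> {for t, continuous x}) /\
  (forall t : R, 0 < t -> ~ switch_instant sigma t ->
      is_derive t 1 x (f (sigma t) (x t))).

Definition GAS (R : realType) (d N : nat) (f : 'I_N -> 'rV[R]_d -> 'rV[R]_d)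
  (sigma : R -> 'I_N) : Prop :=
  exists beta : R -> R -> R, class_KL beta /\
    forall x0 x, switched_solution f sigma x0 x ->
      forall t : R, 0 <= t -> `|x t| <= beta `|x0| t.

(* Main.v *)
Require Import Defs.
From HB Require Import structures.
From mathcomp Require Import all_boot all_order all_algebra.
From mathcomp Require Import all_classical all_reals all_analysis.
From mathcomp Require Import finmap ring lra.
Set Implicit Arguments.
Unset Strict Implicit.
Unset Printing Implicit Defensive.
Import Order.TTheory GRing.Theory Num.Theory.
Import numFieldNormedType.Exports.
Local Open Scope classical_set_scope.
Local Open Scope ring_scope.

(** Since each [f i] is globally Lipschitz, every point [xi] starts a solution of
    [x' = f i x] defined for all [t >= 0]; differentiating the decay hypothesis
    along it at [t = 0] gives the pointwise inequality
    ['D_(f i xi) (V i) xi <= - lam i * V i xi]. Along a switched solution this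
    bounds [V] between two switches, and (A2) bounds its jumps, so that
    [V (sigma t) (x t) <= V (sigma 0) x0 * expR (Phi t)], where [Phi t] collects
    the jump terms [ln mu] and the decay rates weighted by activation times. For
    [t > 0] the quantity in the limsup is [Phi t / t], hence
    [Phi t <= C - eps * t] for some [eps > 0], and
    [beta r t := alo^-1 (ahi r * expR (C - eps * t))] is the required KL bound. *)

(** * Row vectors: norms, derivatives and a mean value inequality *)

Lemma rV_norm_le (R : realType) (d : nat) (x : 'rV[R]_d) (c : R) :
  0 <= c -> (forall j, `|x 0 j| <= c) -> `|x| <= c.
Proof.
move=> c0 xc; rewrite [leLHS]/Num.Def.normr/= mx_normrE bigmax_le// => -[i j] _.
by rewrite ord1.
Qed.

Lemma rV_coord_le (R : realType) (d : nat) (x : 'rV[R]_d) j : `|x 0 j| <= `|x|.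
Proof.
rewrite [leRHS]/Num.Def.normr/= mx_normrE.
exact: (le_bigmax _ (fun i : 'I_1 * 'I_d => `|x i.1 i.2|) (0, j)).
Qed.

Lemma is_derive_rowP (R : realType) (d : nat) (g : R -> 'rV[R]_d)
    (t : R) v :
  is_derive t 1 g v <-> forall j, is_derive t 1 (fun s => g s 0 j) (v 0 j).
Proof.
split=> [[dg <-] j|gv].
  split; first by move/derivable_mxP : dg; exact.
  by rewrite derive_mx// mxE.
have dg : derivable g t 1.
  by apply/derivable_mxP => i j; rewrite ord1; apply: ex_derive; exact: gv.
split=> //; rewrite derive_mx//; apply/rowP => j; rewrite mxE.
by have := gv j; move=> [].
Qed.

Lemma is_derive_continuous (R : realType) (d : nat) (g : R -> 'rV[R]_d) (t : R) v :
  is_derive t 1 g v -> {for t, continuous g}.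
Proof.
by move=> [dg _]; apply: differentiable_continuous; apply/derivable1_diffP.
Qed.

(** Both [h - g] and [h + g] have a nonnegative derivative on the interval, hence are nondecreasing
    there. *)
Lemma is_derive_increment_le (R : realType) (g g' h h' : R -> R) (a b : R) :
  a <= b ->
  (forall t, a <= t <= b -> is_derive t 1 g (g' t)) ->
  (forall t, a <= t <= b -> is_derive t 1 h (h' t)) ->
  (forall t, a <= t <= b -> `|g' t| <= h' t) ->
  `|g b - g a| <= h b - h a.
Proof.
move=> ab dg dh gh.
have mono (k k' : R -> R) : (forall t, a <= t <= b -> is_derive t 1 k (k' t)) ->
    (forall t, a <= t <= b -> 0 <= k' t) -> k a <= k b.
  move=> dk k0.
  apply: (@ger0_derive1_le_cc _ k a b) => //.
  - move=> t; rewrite in_itv/= => /andP[at_ tb].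
    by have [] := dk t; rewrite ?(ltW at_) ?(ltW tb).
  - move=> t; rewrite in_itv/= => /andP[at_ tb]; rewrite derive1E.
    have tab : a <= t <= b by rewrite (ltW at_) (ltW tb).
    by have [_ ->] := dk t tab; exact: k0.
  - apply: derivable_within_continuous => t; rewrite in_itv/= => tab.
    by have [] := dk t tab.
  - by rewrite in_itv/= lexx ab.
  - by rewrite in_itv/= lexx ab.
have h1 : (h - g) a <= (h - g) b.
  apply: (mono _ (fun t => h' t - g' t)) => t tab.
    by have := dg t tab; have := dh t tab => *; exact: is_deriveB.
  by rewrite subr_ge0 (le_trans (ler_norm _))// gh.
have h2 : (h + g) a <= (h + g) b.
  apply: (mono _ (fun t => h' t + g' t)) => t tab.
    by have := dg t tab; have := dh t tab => *; exact: is_deriveD.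
  rewrite -[g' t]opprK subr_ge0 (le_trans (ler_norm _))// normrN; exact: gh.
move: h1 h2; rewrite !fctE => h1 h2; rewrite ler_norml; apply/andP; split; lra.
Qed.

(** * Global solutions of Lipschitz differential equations *)

Lemma antiderivative_ge0 (R : realType) (phi : R -> R) (c : R) :
  continuous phi ->
  exists F : R -> R, F 0 = c /\ forall t : R, 0 <= t -> is_derive t 1 F (phi t).
Proof.
move=> cphi.
(* Integrating from -1 makes 0 an interior point, so that the derivative at 0 is two-sided. *)
pose F (x : R) : R := \int[lebesgue_measure]_(t in `[-1, x]) phi t.
exists (fun x => F x + (c - F 0)); split; first by rewrite addrC subrK.
move=> t t0.
have [dF F't] : derivable F t 1 /\ derive1 F t = phi t.
  apply: (@continuous_FTC1_closed _ phi (-1) t (t + 1)).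
  - by rewrite ltrDl.
  - apply: continuous_compact_integrable; first exact: segment_compact.
    exact: continuous_subspaceT.
  - by rewrite (lt_le_trans _ t0)// ltrN10.
  - exact: cphi.
rewrite -[phi t]addr0; apply: is_deriveD.
by split=> //; rewrite -derive1E.
Qed.

Lemma antiderivative_row_ge0 (R : realType) (d : nat) (phi : R -> 'rV[R]_d) xi :
  continuous phi ->
  exists F : R -> 'rV[R]_d, F 0 = xi /\
    forall t : R, 0 <= t -> is_derive t 1 F (phi t).
Proof.
move=> cphi.
have /choice[F FP] : forall j, exists F : R -> R, F 0 = xi 0 j /\
    forall t : R, 0 <= t -> is_derive t 1 F (phi t 0 j).
  move=> j; apply: antiderivative_ge0 => t.
  apply: (@continuous_comp _ _ _ phi (fun x : 'rV_d => x 0 j)); first exact: cphi.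
  exact: coord_continuous.
exists (fun t => \row_j F j t); split.
  by apply/rowP => j; rewrite mxE (FP j).1.
move=> t t0; apply/is_derive_rowP => j.
have -> : (fun s => (\row_j0 F j0 s) 0 j) = F j by apply/funext => s; rewrite mxE.
exact: (FP j).2.
Qed.

Lemma continuous_nonneg_extension (R : realType) (T : topologicalType)
    (g : R -> T) :
  (forall t : R, 0 <= t -> {for t, continuous g}) ->
  continuous (fun t : R => g (Num.max t 0)).
Proof.
move=> cg t; apply: (@continuous_comp _ _ _ (fun t : R => Num.max t 0) g).
  apply: continuous_max; first exact: cvg_id.
  exact: cvg_cst.
by apply: cg; rewrite le_max lexx orbT.
Qed.

Lemma exists_div_exp2_lt (R : realType) (a e : R) : 0 < e ->
  exists n : nat, a / 2 ^+ n < e.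
Proof.
move=> e0; exists (Num.truncn `|a / e|).+1.
rewrite ltr_pdivrMr ?exprn_gt0// -ltr_pdivrMl// mulrC.
apply: le_lt_trans (ler_norm _) _; apply: lt_le_trans (truncnS_gt _) _.
by rewrite -natrX ler_nat ltnW// ltn_expl.
Qed.

(* Picard iteration, with successive differences controlled in the weighted norm
   [sup_t |.| expR (- 2 L t)], in which each step halves the distance on all of
   [0, +oo[ at once. Integrands are precomposed with [max t 0] so that they are
   continuous on R and the solution is differentiable at 0 on both sides. *)
Lemma lipschitz_global_solution (R : realType) (d : nat)
    (f : 'rV[R]_d -> 'rV[R]_d) (xi : 'rV[R]_d) :
  lipschitz_map f ->
  exists g : R -> 'rV[R]_d, g 0 = xi /\
    forall t : R, 0 <= t -> is_derive t 1 g (f (g t)).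
Proof.
move=> [L0 lipf].
(* A constant at least 1 can be divided by, and gives [1 <= 2 * L * e s] in the base case of
   [step]. *)
pose L := Num.max L0 1.
have L1 : 1 <= L by rewrite le_max lexx orbT.
have L_gt0 : 0 < L by rewrite (lt_le_trans ltr01).
have lipL x y : `|f x - f y| <= L * `|x - y|.
  by rewrite (le_trans (lipf x y))// ler_wpM2r// le_max lexx.
have cf : continuous f.
  move=> x; apply/(@cvgrPdist_lt _ _ _ (nbhs x) (nbhs_filter x)) => e e0.
  have := @nbhsx_ballx _ _ x (e / L) (divr_gt0 e0 L_gt0).
  apply: (@filterS _ (nbhs x)) => y; rewrite -ball_normE/= => xy.
  by rewrite (le_lt_trans (lipL _ _))// -ltr_pdivlMl// mulrC.
pose pos (t : R) := Num.max t 0.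
have pos_ge0 t : 0 <= pos t by rewrite le_max lexx orbT.
have posE t : 0 <= t -> pos t = t by move=> t0; apply/max_idPl.
(* [A] is the Picard operator; its constant value on the remaining [z] only makes it total. *)
have /choice[A AP] : forall z : R -> 'rV[R]_d, exists w : R -> 'rV[R]_d,
    continuous (z \o pos) ->
    w 0 = xi /\ forall t : R, 0 <= t -> is_derive t 1 w (f (z t)).
  move=> z; have [cz|ncz] := pselect (continuous (z \o pos)); last first.
    by exists (cst xi) => /ncz.
  have [|w [w0 dw]] := @antiderivative_row_ge0 R d (f \o (z \o pos)) xi.
    by move=> t; apply: continuous_comp; [exact: cz|exact: cf].
  exists w => _; split=> // t t0; have := dw t t0.
  by rewrite /= posE.
have cA z : continuous (z \o pos) -> continuous (A z \o pos).
  move=> /AP[_ dA]; apply: continuous_nonneg_extension => t t0.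
  exact: is_derive_continuous (dA t t0).
pose y n := iter n A (cst xi).
have cy n : continuous (y n \o pos).
  by elim: n => [|n ih] /=; [move=> t; exact: cvg_cst|exact: cA].
have y_0 n : y n 0 = xi by case: n => // n; exact: (AP (y n) (cy n)).1.
have dy n (t : R) : 0 <= t -> is_derive t 1 (y n.+1) (f (y n t)).
  exact: (AP (y n) (cy n)).2.
pose e t := expR (2 * L * t).
have e_gt0 t : 0 < e t by exact: expR_gt0.
(* [K * e] is an antiderivative of [K * (2 * L * e)]. As [f] is [L]-Lipschitz, arguments of [A] at
   distance [K * e] give integrands at distance [K / 2 * (2 * L * e)], so each application of [A]
   halves the constant. *)
have gronwall (w w' v v' : R -> 'rV[R]_d) K : 0 <= K -> w 0 = w' 0 ->
    (forall t : R, 0 <= t -> is_derive t 1 w (v t)) ->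
    (forall t : R, 0 <= t -> is_derive t 1 w' (v' t)) ->
    (forall t, 0 <= t -> `|v t - v' t| <= K * (2 * L * e t)) ->
    forall t, 0 <= t -> `|w t - w' t| <= K * e t.
  move=> K0 ww' dw dw' vv' t t0.
  apply: rV_norm_le => [|j]; first by rewrite mulr_ge0// ltW.
  have := @is_derive_increment_le R (fun s => (w s - w' s) 0 j)
    (fun s => (v s - v' s) 0 j) (fun s => K * e s)
    (fun s => K * (2 * L * e s)) 0 t t0.
  have -> /= : (w 0 - w' 0) 0 j = 0 by rewrite ww' subrr mxE.
  rewrite subr0 => H.
  have {H} : `|(w t - w' t) 0 j| <= K * e t - K * e 0.
    apply: H => s /andP[s0 _].
    - have /is_derive_rowP : is_derive s 1 (w - w') (v s - v' s).
        by have := dw s s0; have := dw' s s0 => *; exact: is_deriveB.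
      exact.
    - have de : is_derive s 1 e (2 * L * e s).
        rewrite (mulrC _ (e s)).
        apply: (@is_derive1_comp _ expR (fun s => 2 * L * s)).
        by rewrite -[X in is_derive _ _ _ X]mulr1; exact: is_deriveZ.
      exact: is_deriveZ.
    - by apply: le_trans (vv' s s0); exact: rV_coord_le.
  by move/le_trans; apply; rewrite gerBl mulr_ge0// ltW.
pose C := `|f xi|.
have step n t : 0 <= t -> `|y n.+1 t - y n t| <= C / 2 ^+ n * e t.
  elim: n t => [|n ih] t t0.
    apply: (gronwall _ _ (fun=> f xi) (fun=> 0)) => //.
    - by rewrite divr_ge0// normr_ge0.
    - move=> s s0; rewrite subr0 expr0 divr1 ler_peMr ?normr_ge0//.
      have : 1 <= e s by rewrite /e -expR0 ler_expR !mulr_ge0// ltW.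
      by move: L1; nra.
  apply: (gronwall _ _ (f \o y n.+1) (f \o y n)) => //=.
  - by rewrite divr_ge0// ?normr_ge0// exprn_ge0.
  - exact: etrans (y_0 n.+2) (esym (y_0 n.+1)).
  - move=> s s0; rewrite (le_trans (lipL _ _))//.
    have := ih s s0; rewrite -(ler_pM2l L_gt0) => /le_trans; apply.
    by rewrite exprS invfM; lra.
(* The coefficient is the exact geometric sum of the constants in [step], a form that survives
   induction on [k]. *)
have tele n k t : 0 <= t ->
    `|y (n + k)%N t - y n t| <= (2 * C / 2 ^+ n - 2 * C / 2 ^+ (n + k)) * e t.
  move=> t0; elim: k => [|k ih]; first by rewrite addn0 !subrr normr0 mul0r.
  rewrite addnS -(subrKA (y (n + k)%N t)) (le_trans (ler_normD _ _))//.
  have := step (n + k)%N t t0; move: ih; rewrite exprS.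
  set a := 2 * C / 2 ^+ n; rewrite invfM.
  set b := (2 ^+ (n + k))^-1.
  lra.
have tail n m t : 0 <= t -> (n <= m)%N ->
    `|y m t - y n t| <= 2 * C / 2 ^+ n * e t.
  move=> t0 nm; rewrite -(subnKC nm) (le_trans (tele _ _ _ t0))//.
  by rewrite ler_pM2r// gerBl divr_ge0 ?exprn_ge0// mulr_ge0// normr_ge0.
have cvgy t : 0 <= t -> cvgn (y ^~ t).
  move=> t0; apply/cauchy_cvgP; apply: cauchy_exP => eps eps0.
  have [n nP] := exists_div_exp2_lt (2 * C * e t) eps0.
  exists (y n t); exists n => // m /= nm; rewrite -ball_normE/=.
  by rewrite distrC (le_lt_trans (tail _ _ _ t0 nm))// mulrAC.
pose x t := limn (y ^~ t).
have xy n t : 0 <= t -> `|x t - y n t| <= 2 * C / 2 ^+ n * e t.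
  move=> t0; apply/ler_addgt0Pr => eps eps0.
  have /cvgrPdist_lt/(_ _ eps0)[m _ mP] := cvgy t t0.
  rewrite -(subrKA (y (maxn m n) t)) (le_trans (ler_normD _ _))// addrC lerD//.
    by rewrite tail// leq_maxr.
  by apply/ltW/mP; exact: leq_maxl.
have cx : continuous (x \o pos).
  move=> t; apply/cvgrPdist_lt => eps eps0.
  (* [M] is the largest weight on [[0, pos t + 1]], so the iterates converge uniformly there and a
     three-epsilon argument applies. *)
  pose M := e (pos t + 1).
  have [|n nP] := @exists_div_exp2_lt _ (2 * C * M) (eps / 3).
    by rewrite divr_gt0.
  have close s : pos s <= pos t + 1 -> `|x (pos s) - y n (pos s)| < eps / 3.
    move=> st; rewrite (le_lt_trans _ nP)// (le_trans (xy n _ (pos_ge0 s)))//.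
    rewrite mulrAC ler_pM2r ?invr_gt0 ?exprn_gt0// ler_wpM2l//.
      by rewrite mulr_ge0// normr_ge0.
    by rewrite ler_expR ler_pM2l// mulr_gt0.
  near=> s => /=.
  have st : pos s <= pos t + 1.
    rewrite /pos ge_max; apply/andP; split; last first.
      by rewrite addr_ge0// le_max lexx orbT.
    have : `|t - s| < 1.
      by near: s; have := @nbhsx_ballx _ _ t 1 ltr01; rewrite -ball_normE.
    rewrite ltr_norml => /andP[ts _].
    have : t <= Num.max t 0 by rewrite le_max lexx.
    lra.
  have h1 : `|x (pos t) - y n (pos t)| < eps / 3 by apply: close; rewrite lerDl.
  have h2 := close s st.
  have h3 : `|y n (pos t) - y n (pos s)| < eps / 3.
    near: s; move/cvgrPdist_lt : (cy n t); apply.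
    by rewrite divr_gt0.
  rewrite -(subrKA (y n (pos t))) (le_lt_trans (ler_normD _ _))//.
  rewrite -[y n (pos t) - _](subrKA (y n (pos s))).
  have := ler_normD (y n (pos t) - y n (pos s)) (y n (pos s) - x (pos s)).
  rewrite [X in _ <= _ + X]distrC => h4.
  lra.
have [Ax0 dAx] := AP x cx.
exists (A x); split=> // t t0.
(* [A x] is differentiable by construction, while [x] is only a limit; the two agree because both
   lie within [C / 2 ^+ n * e t] of [y n.+1 t]. *)
suff -> : A x t = x t by exact: dAx.
apply/eqP; rewrite -subr_eq0 -normr_le0.
apply/ler_addgt0Pr => eps eps0; rewrite add0r.
have [n nP] := exists_div_exp2_lt (4 * C * e t) eps0.
have h1 : `|A x t - y n.+1 t| <= C / 2 ^+ n * e t.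
  apply: (gronwall _ _ (f \o x) (f \o y n)) => //=.
  - by rewrite divr_ge0// ?normr_ge0// exprn_ge0.
  - exact: etrans Ax0 (esym (y_0 n.+1)).
  - move=> s s0; rewrite (le_trans (lipL _ _))//.
    have := xy n s s0; rewrite -(ler_pM2l L_gt0) => /le_trans; apply.
    lra.
have h2 := xy n.+1 t t0.
rewrite -(subrKA (y n.+1 t)) (le_trans (ler_normD _ _))//.
rewrite [X in _ + X]distrC (le_trans (lerD h1 h2))// (le_trans _ (ltW nP))//.
have := divr_ge0 (normr_ge0 (f xi)) (exprn_ge0 n (ler0n R 2)).
rewrite -/C => h3; have := mulr_ge0 h3 (ltW (e_gt0 t)).
rewrite exprS invfM.
lra.
Unshelve. all: by end_near. Qed.

(** * Decay of a Lyapunov function within one mode *)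

Lemma is_derive_comp_row (R : realType) (d : nat) (V : 'rV[R]_d -> R)
    (g : R -> 'rV[R]_d) (t : R) (v : 'rV[R]_d) :
  differentiable V (g t) -> is_derive t 1 g v ->
  is_derive t 1 (V \o g) ('D_v V (g t)).
Proof.
move=> dV [dg <-].
have dg' : differentiable g t by apply/derivable1_diffP.
have dVg : differentiable (V \o g) t by exact: differentiable_comp.
split; first by apply/derivable1_diffP.
by rewrite !deriveE// diff_comp.
Qed.

Lemma is_derive_expR_scale (R : realType) (a t : R) :
  is_derive t 1 (fun s => expR (a * s)) (expR (a * t) * a).
Proof.
apply: (@is_derive1_comp _ expR (fun s => a * s)).
by rewrite -[X in is_derive _ _ _ X]mulr1; exact: is_deriveZ.
Qed.

(** All difference quotients from the right are nonpositive, and so is their limit. *)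
Lemma derive_le0_at_right (R : realType) (h : R -> R) (a b : R) :
  is_derive a 1 h b -> (forall t, a < t -> h t <= h a) -> b <= 0.
Proof.
move=> [dh <-] ha.
rewrite /derive cvg_at_rightE//; apply: limr_le.
  exact: cvgP (cvg_dnbhs_at_right dh).
near=> s; have s0 : 0 < s by [].
rewrite /= /GRing.scale/= mulr1 pmulr_rle0 ?invr_gt0// subr_le0.
by apply: ha; rewrite ltrDr.
Unshelve. all: by end_near. Qed.

Lemma lyapunov_derive_le (R : realType) (d : nat) (f : 'rV[R]_d -> 'rV[R]_d)
    (V : 'rV[R]_d -> R) (lam : R) :
  lipschitz_map f -> (forall x, differentiable V x) ->
  (forall g, solution f g ->
     forall t : R, 0 <= t -> V (g t) <= V (g 0) * expR (- lam * t)) ->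
  forall xi, 'D_(f xi) V xi <= - lam * V xi.
Proof.
move=> lipf dV decay xi.
have [g [g0 dg]] := lipschitz_global_solution xi lipf.
have solg : solution f g.
  split=> [t t0|]; first by apply: dg; exact: ltW.
  by apply: cvg_at_right_filter; exact: (is_derive_continuous (dg 0 _)).
rewrite -subr_le0 mulNr opprK.
(* This comparison function vanishes at 0 and is nonpositive afterwards by [decay]; its derivative
   at 0 is the quantity to bound. *)
apply: (@derive_le0_at_right R (fun t => V (g t) - V xi * expR (- lam * t)) 0).
  have -> : 'D_(f xi) V xi + lam * V xi =
      'D_(f (g 0)) V (g 0) - V xi * (expR (- lam * 0) * - lam).
    by rewrite g0 mulr0 expR0; lra.
  apply: is_deriveB; first by apply: is_derive_comp_row => //; exact: dg.
  by have := is_derive_expR_scale (- lam) 0 => ?; exact: is_deriveZ.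
move=> t t0; rewrite g0 mulr0 expR0 mulr1 subrr subr_le0 -g0.
by apply: decay => //; exact: ltW.
Qed.

(** With the integrating factor [expR (lam * t)], the function [V (x t)] becomes nonincreasing.
    Derivatives are taken only in the open interval, since a switched solution may have a corner at
    a switch. *)
Lemma lyapunov_decay (R : realType) (d : nat) (f : 'rV[R]_d -> 'rV[R]_d)
    (V : 'rV[R]_d -> R) (lam : R) (x : R -> 'rV[R]_d) (a b : R) :
  (forall xi, differentiable V xi) ->
  (forall xi, 'D_(f xi) V xi <= - lam * V xi) -> a <= b ->
  {within `[a, b], continuous x} ->
  (forall t : R, a < t < b -> is_derive t 1 x (f (x t))) ->
  V (x b) <= V (x a) * expR (- lam * (b - a)).
Proof.
move=> dV Vle ab cx dx.
pose h (t : R) := V (x t) * expR (lam * t).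
have dh (t : R) : a < t < b -> is_derive t 1 h
    (('D_(f (x t)) V (x t) + lam * V (x t)) * expR (lam * t)).
  move=> tab; have := is_derive_comp_row (dV (x t)) (dx t tab).
  have := is_derive_expR_scale lam t => de dVx.
  have : is_derive t 1 h (V (x t) *: (expR (lam * t) * lam) +
    expR (lam * t) *: 'D_(f (x t)) V (x t)) by exact: is_deriveM.
  by rewrite /GRing.scale/= => dh; apply: is_derive_eq; lra.
have : h b <= h a.
  apply: (@ler0_derive1_le_cc _ h a b) => //; rewrite ?in_itv/= ?lexx ?ab//.
  - by move=> t; rewrite in_itv/= => /dh[].
  - move=> t; rewrite in_itv/= => /dh[_]; rewrite derive1E => ->.
    rewrite mulr_le0_ge0 ?expR_ge0//.
    by have := Vle (x t); lra.
  - move=> t; apply: cvgM.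
      apply: continuous_comp; first exact: cx.
      exact: differentiable_continuous.
    apply: continuous_subspaceT => s; apply: continuous_comp.
      by apply: cvgM; [exact: cvg_cst|exact: cvg_id].
    exact: continuous_expR.
rewrite /h/= -ler_pdivlMr ?expR_gt0// => /le_trans; apply.
rewrite -expRN -mulrA -expRD le_eqVlt; apply/orP/or_introl/eqP.
by congr (_ * expR _); lra.
Qed.

(** * Breakpoints, switch counts and activation times *)

(** This is the part of [admissible] that does not involve [E], with the breakpoints explicit. A
    breakpoint need not be a switch, but every switch is some [tau n.+1]. *)
Definition constant_between (R : realType) (N : nat) (tau : nat -> R)
    (sigma : R -> 'I_N) : Prop :=
  [/\ tau 0%N = 0, forall n, tau n < tau n.+1, tau n @[n --> \oo] --> +oo &
      forall n t, tau n <= t < tau n.+1 -> sigma t = sigma (tau n)].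

Lemma constant_between_lt (R : realType) (N : nat) (tau : nat -> R)
    (sigma : R -> 'I_N) : constant_between tau sigma ->
  {mono tau : m n / (m <= n)%N >-> m <= n}.
Proof. by move=> [_ tauS _ _]; apply/increasing_seqP. Qed.

Lemma constant_between_locate (R : realType) (N : nat) (tau : nat -> R)
    (sigma : R -> 'I_N) (t : R) : constant_between tau sigma -> 0 <= t ->
  exists n, tau n <= t < tau n.+1.
Proof.
move=> [tau0 _ tauy _] t0.
have ex : exists n, t < tau n.
  have /cvgryPgt/(_ t)[n _ nP] := tauy.
  by exists n; apply: nP => /=.
case: (ex_minnP ex) => -[|n] tn nmin; first by move: tn; rewrite tau0 ltNge t0.
exists n; rewrite tn andbT leNgt; apply/negP => /nmin.
by rewrite ltnn.
Qed.

Lemma constant_between_inside (R : realType) (N : nat) (tau : nat -> R)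
    (sigma : R -> 'I_N) (n : nat) (t : R) : constant_between tau sigma ->
  tau n < t < tau n.+1 -> ~ switch_instant sigma t.
Proof.
move=> [_ _ _ cst_sigma] /andP[nt tn] [k [l [t0 [kl [stl [delta [delta0 sk]]]]]]].
(* [u] lies both in the current interval and in the window of length [delta] before [t], so that
   [sigma u] equals [k] as well as [sigma t]. *)
pose u := Num.max (tau n) (t - delta / 2).
have ut : u < t by rewrite gt_max nt ltrBlDr ltrDl divr_gt0.
have su : sigma u = k.
  apply: sk; rewrite ut andbT lt_max; apply/orP; right.
  by rewrite ltrD2l ltrN2 gtr_pMr// invf_lt1// ltr1n.
move/negP : kl; apply; rewrite -su -stl.
rewrite (cst_sigma n u) ?(cst_sigma n t)//; first by rewrite ltW.
by rewrite le_max lexx/= (lt_trans ut).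
Qed.

Lemma switch_at_boundary (R : realType) (N : nat) (tau : nat -> R)
    (sigma : R -> 'I_N) (n : nat) (k l : 'I_N) : constant_between tau sigma ->
  switch_at sigma k l (tau n.+1) <->
  [&& k != l, sigma (tau n) == k & sigma (tau n.+1) == l].
Proof.
move=> ctau; have tau_le := constant_between_lt ctau.
have [tau0 tauS _ cst_sigma] := ctau.
split=> [[_ [-> [stl [delta [delta0 sk]]]]]|/and3P[kl /eqP sk /eqP sl]].
  rewrite stl eqxx andbT/=; apply/eqP.
  pose u := Num.max (tau n) (tau n.+1 - delta / 2).
  have ut : u < tau n.+1 by rewrite gt_max tauS ltrBlDr ltrDl divr_gt0.
  rewrite -(cst_sigma n u); last by rewrite ut le_max lexx.
  apply: sk; rewrite ut andbT lt_max; apply/orP; right.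
  by rewrite ltrD2l ltrN2 gtr_pMr// invf_lt1// ltr1n.
split; first by rewrite -tau0 ltNge tau_le.
split=> //; split=> //; exists (tau n.+1 - tau n); split; first by rewrite subr_gt0.
by move=> u; rewrite subKr => /andP[nu un]; rewrite (cst_sigma n u)// un ltW.
Qed.

Lemma switch_instant_tau (R : realType) (N : nat) (tau : nat -> R)
    (sigma : R -> 'I_N) (s : R) : constant_between tau sigma ->
  0 < s -> switch_instant sigma s -> exists n, s = tau n.+1.
Proof.
move=> ctau s0 sws; have [n /andP[ns sn]] := constant_between_locate ctau (ltW s0).
move: ns; rewrite le_eqVlt => /predU1P[ns|ns]; last first.
  by exfalso; apply: (constant_between_inside ctau (n := n) (t := s)) sws; rewrite ns.
case: n ns {sn} => [|n] ns; last by exists n.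
by have [tau0 _ _ _] := ctau; move: s0; rewrite -ns tau0 ltxx.
Qed.

(** Switches up to [t] are among finitely many breakpoints. Finiteness matters because [fset_set]
    sends an infinite set to the empty one, which would falsify the counts. *)
Lemma finite_switch_instants (R : realType) (N : nat) (tau : nat -> R)
    (sigma : R -> 'I_N) (t : R) : constant_between tau sigma ->
  finite_set [set u | 0 < u <= t /\ switch_instant sigma u].
Proof.
move=> ctau; have tau_le := constant_between_lt ctau.
have [t0|t0] := leP 0 t; last first.
  apply: (sub_finite_set _ (finite_set0 _)) => u [/andP[u0 ut] _].
  by have := lt_trans (lt_le_trans u0 ut) t0; rewrite ltxx.
have [m /andP[_ tm]] := constant_between_locate ctau t0.
apply: (sub_finite_set _ (finite_image tau (finite_II m.+1))) => u [/andP[u0 ut]].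
move=> /(switch_instant_tau ctau u0)[n un].
exists n.+1; last exact: esym.
by rewrite /= ltnNge -tau_le -un -ltNge (le_lt_trans ut).
Qed.

Lemma finite_switch_at (R : realType) (N : nat) (tau : nat -> R)
    (sigma : R -> 'I_N) (k l : 'I_N) (t : R) : constant_between tau sigma ->
  finite_set [set u | 0 < u <= t /\ switch_at sigma k l u].
Proof.
move=> ctau; apply: (sub_finite_set _ (finite_switch_instants t ctau)).
by move=> u [ut sw]; split=> //; exists k, l.
Qed.

(** This covers times before the first switch, where [rho_tr] divides by zero and the product with
    [nu_sw] must still be [Nkl] over [t]. *)
Lemma Nkl_eq0 (R : realType) (N : nat) (tau : nat -> R)
    (sigma : R -> 'I_N) (k l : 'I_N) (t : R) : constant_between tau sigma ->
  Nsw sigma 0 t = 0%N -> Nkl sigma k l t = 0%N.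
Proof.
move=> ctau /cardfs0_eq /(congr1 (fun X => [set` X])).
rewrite fset_setK ?set_fset0; last exact: finite_switch_instants ctau.
move=> noswitch; rewrite /Nkl (_ : [set u | _] = set0) ?fset_set0//.
rewrite -subset0 -noswitch => u [ut sw]; split=> //.
by exists k, l.
Qed.

Lemma Nkl_start (R : realType) (N : nat) (sigma : R -> 'I_N) (k l : 'I_N) :
  Nkl sigma k l 0 = 0%N.
Proof.
rewrite /Nkl (_ : [set u | _] = set0) ?fset_set0//.
rewrite -subset0 => u [/andP[u0 ut] _].
by have := lt_le_trans u0 ut; rewrite ltxx.
Qed.

Lemma Nkl_inside (R : realType) (N : nat) (tau : nat -> R)
    (sigma : R -> 'I_N) (k l : 'I_N) (n : nat) (t : R) :
  constant_between tau sigma -> tau n <= t < tau n.+1 ->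
  Nkl sigma k l t = Nkl sigma k l (tau n).
Proof.
move=> ctau /andP[nt tn]; rewrite /Nkl; congr (#|` fset_set _|).
apply/seteqP; split=> u [/andP[u0 ut] sw]; split=> //; rewrite u0/=; last first.
  exact: le_trans nt.
rewrite leNgt; apply/negP => nu.
apply: (constant_between_inside ctau (n := n) (t := u)); last by exists k, l.
by rewrite nu (le_lt_trans ut).
Qed.

(** Switches are breakpoints, so only [tau n.+1] itself can be new; the boolean is the indicator
    that it is a switch from [k] to [l]. *)
Lemma Nkl_boundary (R : realType) (N : nat) (tau : nat -> R)
    (sigma : R -> 'I_N) (k l : 'I_N) (n : nat) : constant_between tau sigma ->
  Nkl sigma k l (tau n.+1) = (Nkl sigma k l (tau n) +
    [&& k != l, sigma (tau n) == k & sigma (tau n.+1) == l])%N.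
Proof.
move=> ctau; have tau_le := constant_between_lt ctau.
have [tau0 tauS _ _] := ctau.
have swP := switch_at_boundary n k l ctau.
have split_last u : 0 < u <= tau n.+1 /\ switch_at sigma k l u ->
    u = tau n.+1 \/ (0 < u <= tau n /\ switch_at sigma k l u).
  move=> [/andP[u0 un] sw].
  have /(switch_instant_tau ctau u0)[m um] : switch_instant sigma u.
    by exists k, l.
  move: un; rewrite um tau_le leq_eqVlt => /predU1P[->|mn]; [by left|right].
  by rewrite -um; split=> //; rewrite u0 um tau_le.
have [sw|sw] := boolP [&& k != l, sigma (tau n) == k & sigma (tau n.+1) == l].
  have swn := swP.2 sw.
  rewrite /Nkl (_ : [set u | _] =
      tau n.+1 |` [set u | 0 < u <= tau n /\ switch_at sigma k l u]); last first.
    apply/seteqP; split=> u; first exact: split_last.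
    move=> [->|[/andP[u0 un] swu]]; last first.
      by split=> //; rewrite u0 (le_trans un)// ltW.
    by split=> //; rewrite lexx andbT; case: swn.
  rewrite fset_setU1; last exact: finite_switch_at ctau.
  rewrite cardfsU1 in_fset_set; last exact: finite_switch_at ctau.
  rewrite memNset ?addn1 1?addnC ?addn1//.
  by move=> [/andP[_]]; rewrite leNgt tauS.
rewrite addn0; congr (#|` fset_set _|); apply/seteqP; split=> u; last first.
  by move=> [/andP[u0 un] swu]; split=> //; rewrite u0 (le_trans un)// ltW.
move=> swu; have [un|//] := split_last u swu.
by move: swu => [_]; rewrite un => /swP; rewrite (negbTE sw).
Qed.

(** The right end [t] may be [tau n.+1], where the mode may already have changed. Hence [Q] is an
    interval closed or open at [t], a singleton or empty, and the single point does not affect the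
    measure. *)
Lemma mode_between (R : realType) (N : nat) (tau : nat -> R)
    (sigma : R -> 'I_N) (j : 'I_N) (n : nat) (t : R) :
  constant_between tau sigma -> tau n <= t <= tau n.+1 ->
  let Q := [set u | tau n < u <= t] `&` [set u | sigma u = j] in
  measurable Q /\
  lebesgue_measure Q = (if sigma (tau n) == j then t - tau n else 0)%:E.
Proof.
move=> [_ _ _ cst_sigma] /andP[nt tn] Q.
have inside u : tau n < u -> u < t -> sigma u = sigma (tau n).
  by move=> nu ut; apply: cst_sigma; rewrite ltW// (lt_le_trans ut).
move: nt; rewrite le_eqVlt => /predU1P[nt|nt].
  rewrite (_ : Q = set0); first by rewrite measure0 -nt subrr; case: ifP.
  by rewrite -subset0 => u [/andP[nu]]; rewrite -nt leNgt nu.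
have [nj|nj] := eqVneq (sigma (tau n)) j;
    have [tj|/eqP tj] := eqVneq (sigma t) j.
- rewrite (_ : Q = `]tau n, t]%classic).
    by split=> //; rewrite lebesgue_measure_itv/= lte_fin nt EFinB.
  apply/seteqP; split=> u; rewrite /= in_itv/=; first by case.
  move=> nut; split=> //; case/andP: nut => nu.
  by rewrite le_eqVlt => /predU1P[->//|ut]; rewrite /= inside.
- rewrite (_ : Q = `]tau n, t[%classic).
    by split=> //; rewrite lebesgue_measure_itv/= lte_fin nt EFinB.
  apply/seteqP; split=> u; rewrite /= in_itv/=.
    move=> [/andP[nu]]; rewrite le_eqVlt => /predU1P[->/tj//|ut].
    by rewrite nu ut.
  by move=> /andP[nu ut]; split; [rewrite /= nu ltW|rewrite /= inside].
- rewrite (_ : Q = [set t]); first by split=> //; rewrite lebesgue_measure_set1.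
  apply/seteqP; split=> u /=; last by move=> ->; split=> //=; rewrite nt lexx.
  move=> [/andP[nu]]; rewrite le_eqVlt => /predU1P[->//|ut].
  by rewrite /= inside// => /eqP; rewrite (negbTE nj).
- rewrite (_ : Q = set0); first by rewrite measure0.
  rewrite -subset0 => u [/andP[nu]]; rewrite le_eqVlt => /predU1P[->//|ut].
  by rewrite /= inside// => /eqP; rewrite (negbTE nj).
Qed.

Lemma Tact_boundary (R : realType) (N : nat) (tau : nat -> R)
    (sigma : R -> 'I_N) (j : 'I_N) (n : nat) (t : R) :
  constant_between tau sigma -> tau n <= t <= tau n.+1 ->
  Tact sigma j t =
  Tact sigma j (tau n) + (if sigma (tau n) == j then t - tau n else 0).
Proof.
move=> ctau.
pose D (s : R) := [set u | 0 < u <= s] `&` [set u | sigma u = j].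
have tau_le := constant_between_lt ctau; have [tau0 tauS _ _] := ctau.
have split_D m s : tau m <= s -> D s = D (tau m) `|`
    ([set u | tau m < u <= s] `&` [set u | sigma u = j]).
  move=> ms; have taum : 0 <= tau m by rewrite -tau0 tau_le.
  apply/seteqP; split=> u; rewrite /D /=.
    move=> [/andP[u0 us] uj]; have [um|um] := leP u (tau m); [left|right] => //.
      by rewrite u0.
  move=> [[/andP[u0 um] uj]|[/andP[mu us] uj]].
    by rewrite u0 (le_trans um).
  by rewrite us (le_lt_trans taum).
(* Measurability is built up one interval at a time. *)
have mD m : measurable (D (tau m)).
  elim: m => [|m ih].
    rewrite (_ : D _ = set0)// -subset0 => u [/andP[u0]].
    by rewrite tau0 leNgt u0.
  rewrite (split_D m) ?ltW//; apply: measurableU => //.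
  by have [] := @mode_between _ _ _ _ j m (tau m.+1) ctau; rewrite ?lexx ?ltW.
move=> tn; have /andP[nt _] := tn.
have [mQ muQ] := mode_between j ctau tn.
(* [fine] is additive on finite values only; finiteness comes from inclusion in the bounded interval
   from 0 to [tau n]. *)
have Dfin : (lebesgue_measure (D (tau n)) < +oo)%E.
  have : (lebesgue_measure (D (tau n)) <= lebesgue_measure `]0%R, tau n]%classic)%E.
    apply: le_measure; [|apply: mem_set; exact: measurable_itv|].
      by apply: mem_set; exact: mD.
    by move=> u [+ _]; rewrite /= in_itv.
  move/le_lt_trans; apply; rewrite lebesgue_measure_itv/=.
  by case: ifP => _; rewrite ltry.
rewrite /Tact -/(D t) -/(D (tau n)) (split_D n t nt).
rewrite measureU; [|exact: mD|exact: mQ|]; last first.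
  rewrite -subset0 => u [[/andP[_ un] _] [/andP[nu _] _]].
  by move: nu; rewrite ltNge un.
have muQ_fin : lebesgue_measure
    ([set u | tau n < u <= t] `&` [set u | sigma u = j]) \is a fin_num.
  by rewrite muQ.
rewrite fineD//; first by congr (_ + _); exact (congr1 fine muQ).
by rewrite ge0_fin_numE.
Qed.

(** * The exponent governing growth along a switching signal *)

(** This is [Phi t] of the overview. The signed rates let stable and unstable modes share one
    sum. *)
Definition switching_exponent (R : realType) (N : nat) (E : {set 'I_N * 'I_N})
    (lam : 'I_N -> R) (mu : 'I_N -> 'I_N -> R) (sigma : R -> 'I_N)
    (t : R) : R :=
  \sum_(p in E) ln (mu p.1 p.2) * (Nkl sigma p.1 p.2 t)%:R
  - \sum_j lam j * Tact sigma j t.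

Lemma switching_exponent_start (R : realType) (N : nat) (E : {set 'I_N * 'I_N})
    (lam : 'I_N -> R) (mu : 'I_N -> 'I_N -> R) (sigma : R -> 'I_N) :
  switching_exponent E lam mu sigma 0 = 0.
Proof.
rewrite /switching_exponent !big1 ?subr0// => [j _|p _]; last first.
  by rewrite Nkl_start mulr0.
rewrite /Tact (_ : _ `&` _ = set0) ?measure0 ?mulr0//.
rewrite -subset0 => u [/andP[u0 ut] _].
by have := lt_le_trans u0 ut; rewrite ltxx.
Qed.

Lemma sum_lam_Tact (R : realType) (N : nat) (lam : 'I_N -> R) (tau : nat -> R)
    (sigma : R -> 'I_N) (n : nat) (t : R) :
  constant_between tau sigma -> tau n <= t <= tau n.+1 ->
  \sum_j lam j * Tact sigma j t =
  \sum_j lam j * Tact sigma j (tau n) + lam (sigma (tau n)) * (t - tau n).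
Proof.
move=> ctau tn.
under eq_bigr do rewrite (Tact_boundary _ ctau tn) mulrDr.
rewrite big_split/=; congr (_ + _).
rewrite (bigD1 (sigma (tau n)))//= eqxx big1 ?addr0// => j jn.
by rewrite eq_sym (negbTE jn) mulr0.
Qed.

Lemma switching_exponent_inside (R : realType) (N : nat) (E : {set 'I_N * 'I_N})
    (lam : 'I_N -> R) (mu : 'I_N -> 'I_N -> R) (tau : nat -> R)
    (sigma : R -> 'I_N) (n : nat) (t : R) :
  constant_between tau sigma -> tau n <= t < tau n.+1 ->
  switching_exponent E lam mu sigma t =
  switching_exponent E lam mu sigma (tau n) - lam (sigma (tau n)) * (t - tau n).
Proof.
move=> ctau ntn; have /andP[nt tn] := ntn.
rewrite /switching_exponent (sum_lam_Tact _ ctau (n := n)) ?nt ?ltW//.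
under eq_bigr do rewrite (Nkl_inside _ _ ctau ntn).
by rewrite opprD addrA.
Qed.

Lemma switching_exponent_boundary (R : realType) (N : nat)
    (E : {set 'I_N * 'I_N}) (lam : 'I_N -> R) (mu : 'I_N -> 'I_N -> R)
    (tau : nat -> R) (sigma : R -> 'I_N) (n : nat) :
  constant_between tau sigma ->
  (sigma (tau n) != sigma (tau n.+1) ->
    (sigma (tau n), sigma (tau n.+1)) \in E) ->
  switching_exponent E lam mu sigma (tau n.+1) =
  switching_exponent E lam mu sigma (tau n)
  - lam (sigma (tau n)) * (tau n.+1 - tau n)
  + (if sigma (tau n) != sigma (tau n.+1)
     then ln (mu (sigma (tau n)) (sigma (tau n.+1))) else 0).
Proof.
move=> ctau nE; have [_ tauS _ _] := ctau.
rewrite /switching_exponent (sum_lam_Tact _ ctau (n := n)) ?lexx ?ltW//.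
under eq_bigr do rewrite (Nkl_boundary _ _ _ ctau) natrD mulrDr.
rewrite big_split/=.
suff -> : \sum_(p in E) ln (mu p.1 p.2) *
    [&& p.1 != p.2, sigma (tau n) == p.1 & sigma (tau n.+1) == p.2]%:R =
    if sigma (tau n) != sigma (tau n.+1)
    then ln (mu (sigma (tau n)) (sigma (tau n.+1))) else 0 by ring.
(* At a genuine switch exactly one pair contributes, and it is among the summands because the
   transition is admissible. Otherwise the conditions in each indicator contradict each other. *)
case: ifPn => [sw|/negPn/eqP <-].
  rewrite (bigD1 _ (nE sw))/= sw !eqxx/= mulr1 big1 ?addr0// => -[k l]/= /andP[_].
  rewrite xpair_eqE ![_ == sigma _]eq_sym.
  by case: (_ == k); case: (_ == l); rewrite ?andbF ?mulr0.
rewrite big1// => -[k l]/= _; case: eqVneq => [//|]; rewrite ?mulr0//.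
by case: (eqVneq (sigma (tau n)) k) => [->/negbTE ->|_ _]; rewrite mulr0.
Qed.

Lemma rate_switching_exponent (R : realType) (N : nat) (PS : {set 'I_N})
    (E : {set 'I_N * 'I_N}) (lam : 'I_N -> R) (mu : 'I_N -> 'I_N -> R)
    (tau : nat -> R) (sigma : R -> 'I_N) (t : R) :
  constant_between tau sigma ->
  (forall i, i \in PS -> 0 < lam i) -> (forall i, i \notin PS -> lam i < 0) ->
  0 < t ->
  nu_sw sigma t * (\sum_(p in E) ln (mu p.1 p.2) * rho_tr sigma p.1 p.2 t)
  - \sum_(j in PS) `|lam j| * eta_act sigma j t
  + \sum_(k in ~: PS) `|lam k| * eta_act sigma k t =
  switching_exponent E lam mu sigma t / t.
Proof.
move=> ctau lamS lamU t0; rewrite /switching_exponent mulrBl.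
rewrite -addrA; congr (_ + _).
  rewrite mulr_sumr mulr_suml; apply: eq_bigr => p _.
  rewrite /nu_sw /rho_tr.
  (* [Nsw] cancels only when it is nonzero; before any switch both sides are zero. *)
  have [N0|N0] := eqVneq (Nsw sigma 0 t) 0%N.
    by rewrite N0 (Nkl_eq0 _ _ ctau N0) !mul0r mulr0 mul0r.
  have {N0} : (Nsw sigma 0 t)%:R != 0 :> R by rewrite pnatr_eq0.
  move: (lt0r_neq0 t0); set c := _%:R; set m := _%:R => t_neq0 c_neq0.
  by field; rewrite t_neq0 c_neq0.
rewrite mulr_suml [in RHS](bigID (mem PS))/= opprD; congr (_ + _).
  congr (- _); apply: eq_bigr => j jS.
  by rewrite gtr0_norm ?lamS// mulrA.
rewrite -sumrN; apply: eq_big => [k|k]; first by rewrite inE.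
by rewrite inE => kS; rewrite ltr0_norm ?lamU// !mulNr mulrA.
Qed.

(** * Lyapunov bound along a switched solution *)

(** By induction over breakpoints: the decay on each interval and the jump at its end match the
    increments of the exponent, and a last partial interval reaches [t]. *)
Lemma lyapunov_along_switching (R : realType) (d N : nat)
    (f : 'I_N -> 'rV[R]_d -> 'rV[R]_d) (E : {set 'I_N * 'I_N})
    (V : 'I_N -> 'rV[R]_d -> R) (lam : 'I_N -> R) (mu : 'I_N -> 'I_N -> R)
    (tau : nat -> R) (sigma : R -> 'I_N) (x0 : 'rV[R]_d)
    (x : R -> 'rV[R]_d) (t : R) :
  (forall i xi, differentiable (V i) xi) ->
  (forall i xi, 'D_(f i xi) (V i) xi <= - lam i * V i xi) ->
  (forall i j, (i, j) \in E ->
     1 <= mu i j /\ forall xi, V j xi <= mu i j * V i xi) ->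
  constant_between tau sigma ->
  (forall n, sigma (tau n) != sigma (tau n.+1) ->
    (sigma (tau n), sigma (tau n.+1)) \in E) ->
  switched_solution f sigma x0 x -> 0 <= t ->
  V (sigma t) (x t) <=
    V (sigma 0) x0 * expR (switching_exponent E lam mu sigma t).
Proof.
move=> dV Vle muE ctau tauE [x00 [cx0 [cx dx]]] t0.
have [tau0 tauS _ cst_sigma] := ctau; have tau_le := constant_between_lt ctau.
have taun n : 0 <= tau n by rewrite -tau0 tau_le.
(* The right endpoint is included with the old mode, as [x] is continuous there; the change of mode
   is handled separately in [at_tau]. *)
have decay n s : tau n <= s <= tau n.+1 ->
    V (sigma (tau n)) (x s) <=
    V (sigma (tau n)) (x (tau n)) * expR (- lam (sigma (tau n)) * (s - tau n)).
  move=> /andP[ns sn].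
  apply: (@lyapunov_decay _ _ (f (sigma (tau n))) _ _ x (tau n) s) => //.
    move: ns; rewrite le_eqVlt => /predU1P[->|ns].
      by rewrite set_itv1; exact: continuous_subspace1.
    apply/(continuous_within_itvP _ ns); split.
    - move=> u; rewrite in_itv/= => /andP[nu _].
      by apply: cx; rewrite (le_lt_trans (taun n)).
    - have [->|n0] := eqVneq (tau n) 0; first exact: cx0.
      by apply: cvg_at_right_filter; apply: cx; rewrite lt_neqAle eq_sym n0 taun.
    - by apply: cvg_at_left_filter; apply: cx; rewrite (le_lt_trans (taun n)).
  move=> u /andP[nu us]; have un := lt_le_trans us sn.
  rewrite -(cst_sigma n u) ?un ?ltW//; apply: dx.
    by rewrite (le_lt_trans (taun n)).
  by apply: (constant_between_inside ctau (n := n)); rewrite nu un.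
have at_tau n : V (sigma (tau n)) (x (tau n)) <=
    V (sigma 0) x0 * expR (switching_exponent E lam mu sigma (tau n)).
  elim: n => [|n ih].
    by rewrite tau0 switching_exponent_start expR0 mulr1 x00.
  rewrite (switching_exponent_boundary _ _ ctau)//; last exact: tauE.
  have := decay n (tau n.+1); rewrite lexx andbT ltW// => /(_ isT) dn.
  have {dn} : V (sigma (tau n)) (x (tau n.+1)) <= V (sigma 0) x0 *
      expR (switching_exponent E lam mu sigma (tau n) -
            lam (sigma (tau n)) * (tau n.+1 - tau n)).
    apply: (le_trans dn); rewrite expRD mulrA -mulNr ler_pM2r//.
    exact: expR_gt0.
  case: ifPn => [sw|/negPn/eqP <-]; last by rewrite addr0.
  (* Positivity of [mu] lets the jump factor enter the exponent as [expR (ln mu)]. *)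
  have [mu1 Vmu] := muE _ _ (tauE n sw); have mu0 := lt_le_trans ltr01 mu1.
  rewrite -(ler_pM2l mu0) => le_mu; apply: (le_trans (Vmu _)).
  apply: (le_trans le_mu); rewrite [in leRHS]expRD lnK ?posrE//.
  by rewrite mulrCA [leRHS]mulrA mulrAC mulrA.
have [n ntn] := constant_between_locate ctau t0.
rewrite (switching_exponent_inside _ _ _ ctau ntn) (cst_sigma n t ntn).
have /andP[nt tn] := ntn.
have := decay n t; rewrite nt ltW// => /(_ isT) /le_trans; apply.
by rewrite expRD mulrA -mulNr ler_pM2r// expR_gt0.
Qed.

(** * Comparison functions *)

(* Monotone maps have only jump discontinuities, which surjectivity excludes. *)
Lemma class_K_of_surjective (R : realType) (b : R -> R) :
  b 0 = 0 -> (forall x y : R, 0 <= x -> x < y -> b x < b y) ->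
  (forall y, 0 <= y -> exists2 x, 0 <= x & b x = y) -> class_K b.
Proof.
move=> b0 binc bsurj; split; last by split.
have ble x y : 0 <= x -> x <= y -> b x <= b y.
  by move=> x0; rewrite le_eqVlt => /predU1P[->//|xy]; rewrite ltW// binc.
have bge0 x : 0 <= x -> 0 <= b x by move=> x0; rewrite -{1}b0 ble.
apply/subspace_continuousP => x /=; rewrite in_itv/= andbT => x0.
apply/cvgrPdist_lt => e e0.
have [|x2 x20 bx2] := bsurj (b x + e); first by rewrite addr_ge0 ?bge0// ltW.
have xx2 : x < x2.
  rewrite ltNge; apply/negP => /(ble _ _ x20); rewrite bx2.
  by rewrite gerDl leNgt e0.
(* If [b x - e] is negative, it lies below every value of [b] on the half-line and any [x1 < x]
   works; otherwise [x1] is a preimage of it. *)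
have [x1 x1x bx1] : exists2 x1, x1 < x &
    forall y, 0 <= y -> x1 < y -> b x - e < b y.
  have [be0|be0] := ltP (b x - e) 0.
    by exists (x - 1) => [|y y0 _]; [rewrite gtrBl|exact: lt_le_trans (bge0 y y0)].
  have [x1 x10 bx1] := bsurj _ be0; exists x1 => [|y y0 xy].
    rewrite ltNge; apply/negP => /(ble _ _ x0); rewrite bx1.
    by rewrite lerDl oppr_ge0 leNgt e0.
  by rewrite -bx1 binc.
rewrite near_withinE; near=> y; rewrite /= in_itv/= andbT => y0.
have yx1 : x1 < y by near: y; exact: lt_nbhsr.
have yx2 : y < x2 by near: y; exact: lt_nbhsl.
have := binc y x2 y0 yx2; have := bx1 y y0 yx1; rewrite bx2 => h1 h2.
by rewrite /from_subspace ltr_norml; apply/andP; split; lra.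
Unshelve. all: by end_near. Qed.

Lemma class_Kinf_surjective (R : realType) (a : R -> R) :
  class_Kinf a -> forall y, 0 <= y -> exists2 x, 0 <= x & a x = y.
Proof.
move=> [[ca [a0 ainc]] ay] y y0.
have [X X0 yX] : exists2 X, 0 <= X & y <= a X.
  have /cvgryPge/(_ y) aXy := ay.
  have [M [_ MP]] := aXy; exists (Num.max 0 (M + 1)); first by rewrite le_max lexx.
  by apply: MP; rewrite lt_max ltrDl ltr01 orbT.
have [||x] := @IVT _ a 0 X y X0.
- apply: continuous_subspaceW ca => u /=; rewrite !in_itv/= => /andP[->].
  by [].
- by rewrite a0 ge_min y0 le_max yX orbT.
by rewrite in_itv/= => /andP[x0 _] <-; exists x.
Qed.

Lemma class_K_le (R : realType) (a : R -> R) (x y : R) :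
  class_K a -> 0 <= x -> x <= y -> a x <= a y.
Proof.
move=> [_ [_ ainc]] x0; rewrite le_eqVlt => /predU1P[->//|xy].
by rewrite ltW// ainc.
Qed.

Lemma class_K_ge0 (R : realType) (a : R -> R) (x : R) :
  class_K a -> 0 <= x -> 0 <= a x.
Proof. by move=> aK x0; have [_ [<- _]] := aK; exact: class_K_le. Qed.

(** Surjectivity provides preimages and strict monotonicity makes them unique; values of [q] at
    negative arguments are arbitrary. *)
Lemma class_Kinf_inverse (R : realType) (a : R -> R) : class_Kinf a ->
  exists q : R -> R, [/\ forall y, 0 <= y -> 0 <= q y,
    forall y, 0 <= y -> a (q y) = y & forall x, 0 <= x -> q (a x) = x].
Proof.
move=> aK; have [aK' _] := aK; have [_ [_ ainc]] := aK'.
have /choice[q qP] : forall y, exists x, 0 <= y -> 0 <= x /\ a x = y.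
  move=> y; have [y0|y0] := leP 0 y; last by exists 0.
  by have [x x0 <-] := class_Kinf_surjective aK y0; exists x.
exists q; split=> [y /qP[]//|y /qP[]//|x x0].
have [q0 aq] := qP _ (class_K_ge0 aK' x0).
have [qx|xq|//] := ltgtP (q (a x)) x.
  by have := ainc _ _ q0 qx; rewrite aq ltxx.
by have := ainc _ _ x0 xq; rewrite aq ltxx.
Qed.

Lemma class_KL_exponential_decay (R : realType) (a b : R -> R) (C eps : R) :
  class_Kinf a -> class_Kinf b -> 0 < eps ->
  exists2 beta : R -> R -> R, class_KL beta &
    forall r t x : R, 0 <= r -> 0 <= x ->
      a x <= b r * expR (C - eps * t) -> x <= beta r t.
Proof.
move=> aK bK eps0; have [aK' _] := aK; have [bK' _] := bK.
have [q [q_ge0 aq qa]] := class_Kinf_inverse aK.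
have qlt x y : 0 <= x -> x < y -> q x < q y.
  move=> x0 xy; have y0 := le_trans x0 (ltW xy).
  rewrite ltNge; apply/negP => /(class_K_le aK' (q_ge0 y y0)).
  by rewrite !aq// leNgt xy.
have qle x y : 0 <= x -> x <= y -> q x <= q y.
  by move=> x0; rewrite le_eqVlt => /predU1P[->//|xy]; rewrite ltW// qlt.
have w_ge0 r t : 0 <= r -> 0 <= b r * expR (C - eps * t).
  by move=> r0; rewrite mulr_ge0 ?expR_ge0// (class_K_ge0 bK').
exists (fun r t => q (b r * expR (C - eps * t))); last first.
  by move=> r t x r0 x0 ax; rewrite -[leLHS]qa// qle// (class_K_ge0 aK').
have [_ [a0 ainc]] := aK'; have [_ [b0 binc]] := bK'.
split=> [t t0|r r0]; [|split].
- apply: class_K_of_surjective.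
  + by rewrite b0 mul0r -{1}a0 qa.
  + by move=> x y x0 xy; rewrite qlt ?w_ge0// ltr_pM2r ?expR_gt0// binc.
  + move=> y y0.
    (* The preimage of [y] is found by solving [q (b x * expR (C - eps * t)) = y] for [b x]. *)
    have [|x x0 bx] :=
        class_Kinf_surjective bK (y := a y * expR (- (C - eps * t))).
      by rewrite mulr_ge0 ?expR_ge0// (class_K_ge0 aK').
    by exists x => //; rewrite bx -mulrA -expRD addNr expR0 mulr1 qa.
- move=> s t s0 st; rewrite qle ?w_ge0// ler_wpM2l ?(class_K_ge0 bK')//.
  by rewrite ler_expR lerD2l lerN2 ler_pM2l.
- apply/cvgrPdist_lt => e e0.
  have ae0 : 0 < a e by rewrite -a0 ainc.
  near=> t.
  rewrite sub0r normrN ger0_norm ?q_ge0 ?w_ge0//.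
  rewrite -[ltRHS](qa e) ?ltW// qlt ?w_ge0//.
  (* Moving [expR (eps * t)] to the right and bounding it below by [1 + eps * t] leaves an
     inequality linear in [t]. *)
  rewrite expRB mulrA ltr_pdivrMr ?expR_gt0//.
  apply: (@lt_le_trans _ _ (a e * (1 + eps * t))); last first.
    by rewrite ler_pM2l// expR_ge1Dx.
  rewrite -ltr_pdivrMl// -ltrBlDl -ltr_pdivrMl//.
  by near: t; apply: nbhs_pinfty_gt; exact: num_real.
Unshelve. all: by end_near. Qed.

(** * From the limsup condition to an affine bound *)

(** The limsup is an infimum of suprema over neighbourhoods of [+oo], so one of these suprema is
    already negative. *)
Lemma limsup_pinfty_lt0 (R : realType) (g : R -> R) :
  (limsup_pinfty g < 0)%E ->
  exists eps T : R, 0 < eps /\ forall t, T < t -> g t <= - eps.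
Proof.
move=> /ereal_inf_lt[_ [A [T [_ TA]] <-] supA].
have g_le t : T < t -> ((g t)%:E <= ereal_sup [set (g t)%:E | t in A])%E.
  by move=> Tt; apply: ereal_sup_ubound; exists t => //; exact: TA.
move: supA g_le; case: (ereal_sup _) => [r| |] //.
- rewrite lte_fin => r0 g_le; exists (- r), T; split; first by rewrite oppr_gt0.
  by move=> t /g_le; rewrite lee_fin opprK.
(* No real lies below a supremum equal to [-oo], so the choice of 1 is arbitrary. *)
- by move=> _ g_le; exists 1, T; split=> // t /g_le.
Qed.

(** On each of the finitely many intervals before [tau m] the exponent is affine in [t], hence
    bounded. *)
Lemma switching_exponent_bounded (R : realType) (N : nat)
    (E : {set 'I_N * 'I_N}) (lam : 'I_N -> R) (mu : 'I_N -> 'I_N -> R)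
    (tau : nat -> R) (sigma : R -> 'I_N) (m : nat) :
  constant_between tau sigma ->
  exists B, forall t, 0 <= t < tau m -> switching_exponent E lam mu sigma t <= B.
Proof.
move=> ctau; have [tau0 tauS _ _] := ctau.
elim: m => [|m [B BP]].
  by exists 0 => t; rewrite tau0 => /andP[t0]; rewrite ltNge t0.
pose B' := switching_exponent E lam mu sigma (tau m) +
  `|lam (sigma (tau m))| * (tau m.+1 - tau m).
exists (Num.max B B') => t /andP[t0 tm]; rewrite le_max.
have [mt|tm'] := leP (tau m) t; last by rewrite BP// t0.
apply/orP; right; rewrite (switching_exponent_inside _ _ _ ctau (n := m)) ?mt//.
rewrite /B' lerD2l -mulNr (@le_trans _ _ (`|lam (sigma (tau m))| * (t - tau m)))//.
  by rewrite ler_wpM2r ?subr_ge0// -normrN ler_norm.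
by rewrite ler_wpM2l// lerD2r ltW.
Qed.

Lemma switching_exponent_le_affine (R : realType) (N : nat)
    (E : {set 'I_N * 'I_N}) (lam : 'I_N -> R) (mu : 'I_N -> 'I_N -> R)
    (tau : nat -> R) (sigma : R -> 'I_N) (eps T : R) :
  constant_between tau sigma -> 0 < eps ->
  (forall t, 0 < t -> T < t -> switching_exponent E lam mu sigma t <= - eps * t) ->
  exists C, forall t, 0 <= t -> switching_exponent E lam mu sigma t <= C - eps * t.
Proof.
move=> ctau eps0 expT.
have [|m /andP[_ Tm]] := constant_between_locate (t := Num.max T 0) ctau.
  by rewrite le_max lexx orbT.
move: Tm; rewrite gt_max => /andP[Tm m0].
have [B BP] := switching_exponent_bounded E lam mu m.+1 ctau.
(* The term [eps * tau m.+1] pays for [- eps * t] before that breakpoint; beyond it, [expT] applies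
   and a nonnegative constant suffices. *)
exists (Num.max 0 B + eps * tau m.+1) => t t0.
have := lexx (Num.max 0 B); rewrite {1}ge_max => /andP[M0 MB].
have em0 : 0 < eps * tau m.+1 by rewrite mulr_gt0.
have [tm|mt] := ltP t (tau m.+1); last first.
  by have := expT t (lt_le_trans m0 mt) (lt_le_trans Tm mt); lra.
have h1 : switching_exponent E lam mu sigma t <= B by rewrite BP// t0.
have : eps * t <= eps * tau m.+1 by rewrite ler_pM2l// ltW.
lra.
Qed.

(** * Global asymptotic stability *)

Theorem theorem5 (R : realType) (d N : nat)
  (f : 'I_N -> 'rV[R]_d -> 'rV[R]_d)
  (PS : {set 'I_N}) (E : {set 'I_N * 'I_N})
  (V : 'I_N -> 'rV[R]_d -> R) (lam : 'I_N -> R) (mu : 'I_N -> 'I_N -> R)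
  (alo ahi : R -> R) :
  (forall i, lipschitz_map (f i)) ->
  (forall i, f i 0 = 0) ->
  (* (A1) *)
  class_Kinf alo -> class_Kinf ahi ->
  (forall i, C1 (V i)) ->
  (forall i xi, 0 <= V i xi) ->
  (forall i, i \in PS -> 0 < lam i) ->
  (forall i, i \notin PS -> lam i < 0) ->
  (forall i xi, alo `|xi| <= V i xi /\ V i xi <= ahi `|xi|) ->
  (forall i g, solution (f i) g ->
     forall t : R, 0 <= t -> V i (g t) <= V i (g 0) * expR (- lam i * t)) ->
  (* (A2) *)
  (forall i j, (i, j) \in E ->
     1 <= mu i j /\ forall xi, V j xi <= mu i j * V i xi) ->
  forall sigma : R -> 'I_N, admissible E sigma ->
  (limsup_pinfty (fun t =>
      nu_sw sigma t * (\sum_(p in E) ln (mu p.1 p.2) * rho_tr sigma p.1 p.2 t)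
      - \sum_(j in PS) `|lam j| * eta_act sigma j t
      + \sum_(k in ~: PS) `|lam k| * eta_act sigma k t)%R < 0%E)%E ->
  GAS f sigma.
Proof.
move=> lipf _ aloK ahiK C1V V_ge0 lamS lamU Vbnd decay muE sigma.
move=> [tau [tau0 [tauS [tauy [cst_sigma tauE]]]]] rate.
have ctau : constant_between tau sigma by [].
have dV i xi : differentiable (V i) xi by have [] := C1V i.
have Vle i xi : 'D_(f i xi) (V i) xi <= - lam i * V i xi.
  exact: lyapunov_derive_le (lipf i) (dV i) (decay i) xi.
have [eps [T [eps0 rateT]]] := limsup_pinfty_lt0 rate.
have [|C expC] :=
    @switching_exponent_le_affine _ _ E lam mu tau sigma eps T ctau eps0.
  move=> t t0 /rateT; rewrite (rate_switching_exponent _ _ ctau)//.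
  by rewrite ler_pdivrMr.
have [beta betaKL betaP] := class_KL_exponential_decay C aloK ahiK eps0.
exists beta; split=> // x0 x sol t t0; apply: betaP => //.
(* The chain runs from [alo] at the current state through [V (sigma t) (x t)] and
   [V (sigma 0) x0 * expR (Phi t)] to [ahi] at the initial state times [expR (C - eps * t)]. *)
have [/le_trans aloV _] := Vbnd (sigma t) (x t); apply: aloV.
have := lyapunov_along_switching dV Vle muE ctau tauE sol t0.
move/le_trans; apply.
have [_ Vahi] := Vbnd (sigma 0) x0.
by rewrite ler_pM ?expR_ge0 ?ler_expR ?expC.
Qed.
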